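(* Let $\gamma$ be a smooth strictly convex closed curve in the Euclidean plane, normalized to have unit length. Let $R_{p,q}$ be the greatest perimeter of the $q$-gons with rotation number $p$ inscribed in $\gamma$. Then for all relatively prime positive integers $p,q$ with $0<\frac pq<1$, $$R_{p,q-1}+R_{p,q+1}<2R_{p,q}.$$
   Context: Parameterize $\gamma$ counterclockwise by arc length and view it as a $1$-periodic map $\gamma:\mathbb{R}\to\mathbb{R}^2$. An inscribed $q$-gon with rotation number $p$ is given by real numbers $x_0\le x_1\le\dots\le x_q=x_0+p$ with $0\le x_{i+1}-x_i\le1$ for all $i$; its vertices are $\gamma(x_0),\dots,\gamma(x_{q-1})$ in this cyclic order (it may be star-shaped, multiply traversed or degenerate), and its perimeter is $\sum_{i=0}^{q-1}|\gamma(x_{i+1})-\gamma(x_i)|$. The integers $p\le q$ in the definition of $R_{p,q}$ need not be relatively prime. *)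

(* Defs.v *)
From HB Require Import structures.
From mathcomp Require Import all_boot all_order all_algebra.
From mathcomp Require Import all_classical all_reals all_analysis.

Set Implicit Arguments.
Unset Strict Implicit.
Unset Printing Implicit Defensive.

Import Order.TTheory GRing.Theory Num.Theory.
Import numFieldNormedType.Exports.

Local Open Scope ring_scope.
Local Open Scope classical_set_scope.

(* The norm that the library puts on [R * R] is the sup norm; it induces the
   Euclidean topology, but lengths have to be measured with [enorm]. *)
Definition enorm (R : realType) (v : R * R) : R :=
  Num.sqrt (v.1 ^+ 2 + v.2 ^+ 2).

(* Rotation by a right angle counterclockwise. *)
Definition rot90 (R : realType) (v : R * R) : R * R := (- v.2, v.1).

Definition smooth (R : realType) (f : R -> R * R) : Prop :=
  forall (n : nat) (t : R), derivable f^`(n) t 1.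

Definition strictly_convex_set (R : realType) (K : set (R * R)) : Prop :=
  forall (a b : R * R) (l : R), K a -> K b -> a != b -> 0 < l < 1 ->
  K° ((1 - l) *: a + l *: b).

(* [g] is a simple closed curve of length 1, parameterized by arc length on R
   with period 1, which is the boundary of a compact strictly convex region [K].
   Counterclockwise means that [K] lies to the left of [g]: the normal
   [rot90 (g^`() t)] at [g t] points into the interior of [K]. *)
Definition strictly_convex_unit_curve (R : realType) (g : R -> R * R) : Prop :=
  [/\ smooth g,
      periodic g 1,
      {in `[0, 1[ &, injective g},
      forall t, enorm (g^`() t) = 1 &
      exists K : set (R * R),
        [/\ compact K,
            strictly_convex_set K,
            range g = K `\` K° &
            forall t, \forall h \near 0^'+, K° (g t + h *: rot90 (g^`() t))]].

(* Only the entries [x 0, ..., x q] of the sequence [x] matter. *)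
Definition inscribed_polygon (R : realType) (p q : nat) (x : nat -> R) : Prop :=
  x q = x 0%N + p%:R /\
  (forall i : nat, (i < q)%N -> 0 <= x i.+1 - x i <= 1).

Definition perimeter (R : realType) (g : R -> R * R) (q : nat) (x : nat -> R)
    : R :=
  \sum_(i < q) enorm (g (x i.+1) - g (x i)).

(* When [p <= q] this supremum is a maximum, see [max_perimeterP]. *)
Definition max_perimeter (R : realType) (g : R -> R * R) (p q : nat) : R :=
  sup [set perimeter g q x | x in inscribed_polygon p q].

Lemma enorm_continuous (R : realType) : continuous (@enorm R).
Proof.
move=> v; apply: (@continuous_comp _ _ _ (fun v : R * R => v.1 ^+ 2 + v.2 ^+ 2)
  (@Num.sqrt R)); last exact: sqrt_continuous.
by apply: cvgD; rewrite !expr2; apply: cvgM; (exact: cvg_fst || exact: cvg_snd).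
Qed.

Lemma perimeter_shift (R : realType) (g : R -> R * R) (q : nat) (x : nat -> R)
    (m : int) :
  periodic g 1 -> perimeter g q (fun i => x i + m%:~R) = perimeter g q x.
Proof.
move=> gP.
have gn (n : nat) t : g (t + n%:R) = g t.
  elim: n t => [|n IH] t; first by rewrite addr0.
  by rewrite -natr1 addrA gP IH.
have gm t : g (t + m%:~R) = g t.
  case: m => n; first exact: gn.
  by rewrite NegzE mulrNz -[in RHS](subrK n.+1%:R t) gn.
by apply: eq_bigr => i _; rewrite !gm.
Qed.

Lemma max_perimeterP (R : realType) (g : R -> R * R) (p q : nat) :
  continuous g -> periodic g 1 -> (p <= q)%N ->
  exists x : nat -> R,
    [/\ inscribed_polygon p q x,
        max_perimeter g p q = perimeter g q x &
        forall y, inscribed_polygon p q y -> perimeter g q y <= perimeter g q x].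
Proof.
move=> gC gP pq.
pose X (u : 'rV[R]_q.+1) i := u 0 (inord i).
have XC i : continuous (X^~ i) by move=> u; exact: coord_continuous.
pose B : set 'rV[R]_q.+1 := [set u | forall i, `[0, q.+1%:R] (u 0 i)].
pose A : set 'rV[R]_q.+1 := B `&` [set u | inscribed_polygon p q (X u)].
have cB : compact B.
  exact: (@rV_compact R q.+1 (fun=> `[0, q.+1%:R]) (fun=> @segment_compact _ _ _)).
have cA : compact A.
  apply: compact_closedI => //.
  rewrite (_ : [set u | _] = [set u | X u q - X u 0%N = p%:R] `&`
     \bigcap_(i in [set i | (i < q)%N]) [set u | `[0, 1] (X u i.+1 - X u i)]);
    last first.
    apply/seteqP; split => u.
      by move=> [] /= -> h; split; [rewrite addrC addKr|move=> i /h; rewrite /= in_itv].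
    move=> [] /= h1 h2; split; first by rewrite -h1 addrC subrK.
    by move=> i /h2; rewrite /= in_itv.
  have dC i j : continuous (fun u => X u i - X u j).
    by move=> u; apply: (@continuousB R R _ (X^~ i) (X^~ j) u); exact: XC.
  apply: closedI.
    apply: (@preimage_closed _ _ (fun u => X u q - X u 0%N) [set p%:R]).
      by move=> u _; exact: dC.
    exact: closed_eq.
  apply: closed_bigI => i _.
  apply: (@preimage_closed _ _ (fun u => X u i.+1 - X u i) `[0, 1]).
    by move=> u _; exact: dC.
  exact: interval_closed.
have fC : continuous (fun u => perimeter g q (X u)).
  apply: (@continuous_big _ _ _ _ xpredT add_continuous) => i _ u.
  apply: (@continuous_comp _ _ _ (fun u => g (X u i.+1) - g (X u i)) (@enorm R));
    last exact: enorm_continuous.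
  apply: (@continuousB R _ _ (fun u => g (X u i.+1)) (fun u => g (X u i)) u).
    by apply: (@continuous_comp _ _ _ (X^~ i.+1) g); [exact: XC|exact: gC].
  by apply: (@continuous_comp _ _ _ (X^~ i) g); [exact: XC|exact: gC].
have red y : inscribed_polygon p q y ->
    exists2 u, A u & perimeter g q (X u) = perimeter g q y.
  move=> [yq yi].
  pose z i := y i + (- Num.floor (y 0%N))%:~R.
  have zq : z q = z 0%N + p%:R by rewrite /z yq addrAC.
  have zi i : (i < q)%N -> 0 <= z i.+1 - z i <= 1.
    by move=> iq; rewrite /z opprD addrACA subrr addr0; exact: yi.
  have z0 : 0 <= z 0%N <= 1.
    rewrite /z mulrNz subr_ge0 floor_le /= lerBlDr addrC -[1]/(1%:~R) -intrD.
    by rewrite ltW// floorD1_gt.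
  have zb i : (i <= q)%N -> 0 <= z i <= i.+1%:R.
    elim: i => [//|i IH] iq; have /andP[a b] := IH (ltnW iq).
    have /andP[c d] := zi _ iq.
    rewrite -(subrK (z i) (z i.+1)) addr_ge0//=.
    by rewrite -natr1 addrC lerD.
  pose u : 'rV[R]_q.+1 := \row_i z i.
  have Xu i : (i <= q)%N -> X u i = z i by move=> iq; rewrite /X mxE inordK.
  exists u.
    split.
      move=> i; rewrite /= mxE in_itv /=.
      have iq : (i <= q)%N by rewrite -ltnS.
      have /andP[-> /= h] := zb _ iq.
      by apply: (le_trans h); rewrite ler_nat.
    split; first by rewrite !Xu.
    by move=> i iq; rewrite !Xu ?zi// ltnW.
  rewrite -(perimeter_shift q y (- Num.floor (y 0%N)) gP) -/z.
  by apply: eq_bigr => i _; rewrite !Xu// ltnW.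
have A0 : A !=set0.
  pose y i : R := (minn i p)%:R.
  have : inscribed_polygon p q y.
    split; first by rewrite /y (minn_idPr pq) min0n add0r.
    move=> i _; rewrite /y; case: (ltnP i p) => ip.
      by rewrite (minn_idPl ip) -natr1 addrAC subrr add0r ler01 lexx.
    by rewrite (minn_idPr (leqW ip)) subrr lexx ler01.
  by move=> /red[u Au _]; exists u.
have [u /set_mem[_ Au] umax] :=
  compact_EVT_max A0 cA (continuous_subspaceT fC).
have xmax y : inscribed_polygon p q y -> perimeter g q y <= perimeter g q (X u).
  by move=> /red[v Av <-]; apply: umax; rewrite inE.
exists (X u); split => //.
apply/eqP; rewrite eq_le; apply/andP; split.
  apply: ge_sup; first by exists (perimeter g q (X u)); exists (X u).
  by move=> _ [y hy <-]; exact: xmax.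
apply: ub_le_sup; last by exists (X u).
by exists (perimeter g q (X u)) => _ [y hy <-]; exact: xmax.
Qed.

(* Main.v *)
Require Import Defs.
From mathcomp Require Import all_boot all_order all_algebra.
From mathcomp Require Import all_classical all_reals all_analysis.
From mathcomp Require Import zify ring lra.
Import Order.TTheory GRing.Theory Num.Theory.
Import numFieldNormedType.Exports.
Local Open Scope ring_scope.
Local Open Scope classical_set_scope.

(* The diagonals of a quadrilateral inscribed in the curve are together longer
   than two opposite sides.  Let [x] and [y] be longest polygons with [q - 1] and
   [q + 1] vertices.  Some side of [x] spans a side of [y], and exchanging
   the end points turns these two sides into diagonals; a second exchange of this
   kind, after [y] has gained one vertex on [x], produces two closed polygons
   with [q] vertices and rotation number [p], whose total length is at least
   that of [x] and [y].  In the case of equality all four polygons are longest,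
   and [x] and [y] have a common vertex at an exchange.  Longest polygons obey the
   reflection law, so two consecutive vertices determine the rest; applied to [x]
   and to one of the new polygons, this forces [x] and [y] to agree from some
   vertex on, although they have different numbers of vertices per turn.  For
   [p = q - 1] all polygons [x] have length [0], so that [x] can be chosen to have no
   vertex in common with [y]. *)

(** * Euclidean geometry of the plane *)

Definition cross {R : realType} (u v : R * R) : R := u.1 * v.2 - u.2 * v.1.
Definition dot {R : realType} (u v : R * R) : R := u.1 * v.1 + u.2 * v.2.

Section EuclideanPlane.
Context {R : realType}.
Implicit Types (u v : R * R) (A B C D : R * R).

Lemma crossZ (k l : R) u v : cross (k *: u) (l *: v) = k * l * cross u v.
Proof. by rewrite /cross /= /GRing.scale /=; ring. Qed.

Lemma crossC u v : cross u v = - cross v u.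
Proof. by rewrite /cross; ring. Qed.

Lemma crossNr u v : cross u (- v) = - cross u v.
Proof. by rewrite /cross /=; ring. Qed.

Lemma crossBr u v v' : cross u (v - v') = cross u v - cross u v'.
Proof. by rewrite /cross /=; ring. Qed.

Lemma cross_parallel u v p q : cross p q = 0 ->
  cross u p * cross v q = cross u q * cross v p.
Proof.
move=> pq0; apply/eqP; rewrite -subr_eq0; apply/eqP.
by rewrite -[RHS](mulr0 (cross u v)) -pq0 /cross; ring.
Qed.

Lemma enorm_ge0 u : 0 <= enorm u.
Proof. exact: sqrtr_ge0. Qed.

Lemma enorm_sqr u : enorm u ^+ 2 = u.1 ^+ 2 + u.2 ^+ 2.
Proof. by rewrite sqr_sqrtr// addr_ge0// sqr_ge0. Qed.

Lemma enormN u : enorm (- u) = enorm u.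
Proof. by rewrite /enorm /= !sqrrN. Qed.

Lemma enormB u v : enorm (u - v) = enorm (v - u).
Proof. by rewrite -enormN opprB. Qed.

Lemma enorm0 : enorm (0 : R * R) = 0.
Proof. by rewrite /enorm /= expr0n addr0 sqrtr0. Qed.

Lemma enorm_gt0 u : u != 0 -> 0 < enorm u.
Proof.
case: u => a b h; rewrite sqrtr_gt0 /= lt0r paddr_eq0 ?sqr_ge0//.
rewrite !sqrf_eq0 addr_ge0 ?sqr_ge0// andbT; apply: contraNN h.
by move=> /andP[/eqP -> /eqP ->].
Qed.

Lemma enormZ (k : R) u : 0 <= k -> enorm (k *: u) = k * enorm u.
Proof.
move=> k0; rewrite /enorm /= !exprMn -mulrDr sqrtrM ?sqr_ge0//.
by rewrite sqrtr_sqr ger0_norm.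
Qed.

Lemma enorm_triangle u v : enorm (u + v) <= enorm u + enorm v.
Proof.
have hu := enorm_sqr u; have hv := enorm_sqr v.
have pu := enorm_ge0 u; have pv := enorm_ge0 v.
rewrite -(@ler_pXn2r _ 2)// ?nnegrE ?addr_ge0 ?enorm_ge0//.
rewrite enorm_sqr /=.
(* Cauchy-Schwarz: by Lagrange's identity the squares differ by [cross u v ^+ 2]. *)
have : dot u v <= enorm u * enorm v.
  apply: le_trans (ler_norm _) _.
  rewrite -(@ler_pXn2r _ 2)// ?nnegrE ?mulr_ge0// exprMn hu hv real_normK ?num_real//.
  rewrite /dot -subr_ge0 [X in 0 <= X](_ : _ = cross u v ^+ 2) ?sqr_ge0//.
  by rewrite /cross; ring.
rewrite /dot; nra.
Qed.

Lemma enorm_triangle_lt u v : cross u v != 0 ->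
  enorm (u + v) < enorm u + enorm v.
Proof.
move=> uv0.
have hu := enorm_sqr u; have hv := enorm_sqr v.
have pu := enorm_ge0 u; have pv := enorm_ge0 v.
rewrite -(@ltr_pXn2r _ 2)// ?nnegrE ?addr_ge0 ?enorm_ge0//.
rewrite enorm_sqr /=.
have : dot u v < enorm u * enorm v.
  apply: le_lt_trans (ler_norm _) _.
  rewrite -(@ltr_pXn2r _ 2)// ?nnegrE ?mulr_ge0// exprMn hu hv real_normK ?num_real//.
  rewrite /dot -subr_gt0 [X in 0 < X](_ : _ = cross u v ^+ 2).
    by rewrite exprn_even_gt0.
  by rewrite /cross; ring.
rewrite /dot; nra.
Qed.

(* In convex position the diagonals [AC] and [BD] meet in a point [P], and the
   triangle inequality is applied to [APD] and [BPC]. *)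
Lemma quadrilateral_lt A B C D :
  0 < cross (B - A) (C - A) -> 0 < cross (C - A) (D - A) ->
  0 < cross (B - A) (D - A) -> 0 < cross (C - B) (D - B) ->
  enorm (D - A) + enorm (C - B) < enorm (C - A) + enorm (D - B).
Proof.
set z := cross (B - A) (C - A); set v := cross (C - A) (D - A).
set w := cross (B - A) (D - A); set u := cross (C - B) (D - B).
move=> z0 v0 w0 u0.
(* [z], [v], [w], [u] are twice the areas of [ABC], [ACD], [ABD], [BCD], and both sums give the
   whole quadrilateral. Ratios of areas locate [P]: [AP] is [w / (u + w)] of [AC], and [BP] is
   [z / (v + z)] of [BD]. *)
have uw : u + w = v + z by rewrite /u /w /v /z /cross /=; ring.
have uw0 : u + w != 0 by rewrite gt_eqF// addr_gt0.
have vz0 : v + z != 0 by rewrite gt_eqF// addr_gt0.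
have E1 (k : R) (X Y : R * R) :
    0 <= k -> 0 <= 1 - k ->
    enorm (Y - X) = enorm (k *: (Y - X)) + enorm ((1 - k) *: (Y - X)).
  by move=> k0 k1; rewrite !enormZ//; ring.
have compl (a b : R) : a + b != 0 -> 1 - b / (a + b) = a / (a + b).
  by move=> ab; rewrite -[1](divff ab) -mulrBl addrK.
have wp : 0 <= w / (u + w) by rewrite divr_ge0// ltW// addr_gt0.
have wp1 : 0 <= 1 - w / (u + w).
  by rewrite compl//; apply/ltW/divr_gt0 => //; exact: addr_gt0.
have zp : 0 <= z / (v + z) by rewrite divr_ge0// ltW// addr_gt0.
have zp1 : 0 <= 1 - z / (v + z).
  by rewrite compl//; apply/ltW/divr_gt0 => //; exact: addr_gt0.
have comb (x y s : R) (X Y Z : R * R) : s != 0 ->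
    s *: X = x *: Y + y *: Z -> X = (x / s) *: Y + (y / s) *: Z.
  move=> s0 h; apply: (scalerI s0); rewrite h scalerDr !scalerA.
  by rewrite ![s * _]mulrC !divfK.
(* [E2] is [AD = AP + PD] and [E3] is [BC = BP + PC]. *)
have E2 : D - A = (w / (u + w)) *: (C - A) + (1 - z / (v + z)) *: (D - B).
  rewrite compl// -uw; apply: comb => //.
  by congr pair; rewrite /u /w /v /cross /GRing.scale /= /GRing.scale /=; ring.
have E3 : C - B = (1 - w / (u + w)) *: (C - A) + (z / (v + z)) *: (D - B).
  rewrite compl// -uw; apply: comb => //.
  by congr pair; rewrite /u /w /z /cross /GRing.scale /= /GRing.scale /=; ring.
rewrite (E1 _ A C wp wp1) (E1 _ B D zp zp1).
have tri1 := enorm_triangle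
  ((1 - w / (u + w)) *: (C - A)) ((z / (v + z)) *: (D - B)).
rewrite -E3 in tri1.
have tri2 : enorm (D - A) < enorm ((w / (u + w)) *: (C - A)) +
    enorm ((1 - z / (v + z)) *: (D - B)).
  rewrite {1}E2; apply: enorm_triangle_lt; rewrite compl//.
  have -> : cross ((w / (u + w)) *: (C - A)) ((v / (v + z)) *: (D - B)) =
      w / (u + w) * (v / (v + z)) * (v + z).
    have -> : v + z = cross (C - A) (D - B) by rewrite /v /z /cross /=; ring.
    by rewrite crossZ.
  have uw1 := addr_gt0 u0 w0; have vz1 := addr_gt0 v0 z0.
  by rewrite gt_eqF// !mulr_gt0 ?invr_gt0//.
by lra.
Qed.

End EuclideanPlane.

(** * Strictly convex curves *)

Lemma is_derive_fst {R : realType} (g : R -> R * R) (t : R) : derivable g t 1 ->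
  is_derive t 1 (fun s => (g s).1) (g^`() t).1.
Proof.
move=> dg; rewrite derive1E.
have h : h^-1 *: ((g (h *: 1 + t)).1 - (g t).1) @[h --> 0^'] --> ('D_1 g t).1.
  exact: (@cvg_comp _ _ _ _ (@fst R R) _ _ _ dg cvg_fst).
by apply: DeriveDef; [exact: (cvgP _ h)|exact: (cvg_lim _ h)].
Qed.

Lemma is_derive_snd {R : realType} (g : R -> R * R) (t : R) : derivable g t 1 ->
  is_derive t 1 (fun s => (g s).2) (g^`() t).2.
Proof.
move=> dg; rewrite derive1E.
have h : h^-1 *: ((g (h *: 1 + t)).2 - (g t).2) @[h --> 0^'] --> ('D_1 g t).2.
  exact: (@cvg_comp _ _ _ _ (@snd R R) _ _ _ dg cvg_snd).
by apply: DeriveDef; [exact: (cvgP _ h)|exact: (cvg_lim _ h)].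
Qed.

Lemma is_derive_continuous {R : realType} (f : R -> R) (t l : R) :
  is_derive t 1 f l -> {for t, continuous f}.
Proof. by move=> [df _]; apply: differentiable_continuous; exact/derivable1_diffP. Qed.

(** The product [h * f (t + h)] is [h ^+ 2] times the difference quotient; the factor [h] lets one
    statement serve both sides of [t]. *)
Lemma is_derive_sign {R : realType} (f : R -> R) (t l : R) :
  is_derive t 1 f l -> f t = 0 -> 0 < l ->
  \forall h \near 0^', 0 < h * f (t + h).
Proof.
move=> [df dl] ft l0.
have h : h^-1 *: (f (h *: 1 + t) - f t) @[h --> 0^'] --> l by rewrite -dl; exact: df.
move/cvgr_gt: h => /(_ _ l0); apply: filterS2 (nbhs_dnbhs_neq 0) => k /= k0.
rewrite ft subr0 [_%:A]mulr1 addrC => kf.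
have -> : k * f (t + k) = k ^+ 2 * (k^-1 *: f (t + k)).
  by rewrite /GRing.scale /= expr2 -mulrA mulVKf.
by rewrite mulr_gt0// exprn_even_gt0.
Qed.

Lemma is_derive_affine {R : realType} (f g : R -> R) (a b c d t df dg : R) :
  is_derive t 1 f df -> is_derive t 1 g dg ->
  is_derive t 1 (fun s => a * (f s - b) + c * (g s - d)) (a * df + c * dg).
Proof.
move=> hf hg.
have h := is_deriveD (is_deriveZ a (is_deriveB hf (is_derive_cst b t 1)))
  (is_deriveZ c (is_deriveB hg (is_derive_cst d t 1))).
by move: h; rewrite !subr0.
Qed.

Lemma dnbhs_at_right {R : realType} (t : R) (P : R -> Prop) :
  (\forall s \near t^', P s) -> \forall s \near t^'+, P s.
Proof.
by rewrite !near_withinE; apply: filterS => s Ps ts; apply: Ps; rewrite gt_eqF.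
Qed.

Lemma dnbhs_at_left {R : realType} (t : R) (P : R -> Prop) :
  (\forall s \near t^', P s) -> \forall s \near t^'-, P s.
Proof.
by rewrite !near_withinE; apply: filterS => s Ps ts; apply: Ps; rewrite lt_eqF.
Qed.

Lemma frameE {R : realType} (T v : R * R) : T.1 ^+ 2 + T.2 ^+ 2 = 1 ->
  v = dot T v *: T + cross T v *: rot90 T.
Proof.
case: T v => [t1 t2] [v1 v2] /= t12.
congr pair; rewrite /dot /cross /GRing.scale /= /GRing.scale /=.
  by rewrite -[LHS]mul1r -t12; ring.
by rewrite -[LHS]mul1r -t12; ring.
Qed.

Section Curve.
Context {R : realType} {g : R -> R * R} (hg : strictly_convex_unit_curve g).

Lemma curve_derivable t : derivable g t 1.
Proof. by case: hg => sm _ _ _ _; exact: (sm 0%N t). Qed.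

Lemma curve_continuous : continuous g.
Proof.
move=> t; apply: differentiable_continuous.
exact/derivable1_diffP/curve_derivable.
Qed.

Lemma tangent_sqr t : (g^`() t).1 ^+ 2 + (g^`() t).2 ^+ 2 = 1.
Proof. by rewrite -enorm_sqr; case: hg => _ _ _ -> _; rewrite expr1n. Qed.

(* If the convex region had a point [z] on the wrong side of the tangent at
   [g a], a chord from [z] to a nearby point of the curve would meet the normal
   line behind [g a], and [g a] would be interior. *)
Lemma tangent_support (K : set (R * R)) (a : R) (z : R * R) :
  strictly_convex_set K -> range g = K `\` K° ->
  (\forall h \near 0^'+, K° (g a + h *: rot90 (g^`() a))) ->
  K z -> 0 <= cross (g^`() a) (z - g a).
Proof.
move=> sc bd inw Kz; rewrite leNgt; apply/negP => zneg.
have gK t : K (g t) /\ ~ K° (g t).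
  by have : range g (g t) by [exists t]; rewrite bd.
set T := g^`() a in zneg inw *.
have T1 : T.1 ^+ 2 + T.2 ^+ 2 = 1 by exact: tangent_sqr.
(* Such a [y] lies on the normal line behind [g a], and interior points lie on it in front; strict
   convexity makes [g a], which is between them, interior. *)
have behind (y : R * R) : K y -> dot T (y - g a) = 0 ->
    cross T (y - g a) < 0 -> False.
  move=> Ky y0 yneg; set m := - cross T (y - g a).
  have m0 : 0 < m by rewrite oppr_gt0.
  have [h [h0 Kh]] : exists h : R, 0 < h /\ K° (g a + h *: rot90 T).
    near (0 : R)^'+ => h; exists h; split; first by near: h; exact: nbhs_right_gt.
    by near: h.
  have yE : y = g a - m *: rot90 T.
    by rewrite -[LHS](subrK (g a)) [X in X + _](frameE T)// y0 scale0r add0r /m scaleNr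
      opprK addrC.
  have mh : m + h != 0 by rewrite gt_eqF// addr_gt0.
  have [] := gK a => _; apply.
  have -> : g a = (1 - m / (m + h)) *: y + (m / (m + h)) *: (g a + h *: rot90 T).
    rewrite yE.
    move: mh; case: (g a) (rot90 T) => [a1 a2] [t1 t2] mh.
    by congr pair; rewrite /GRing.scale /= /GRing.scale /=; field.
  apply: sc => //; first exact: interior_subset.
    apply/eqP => yy; move: yneg.
    rewrite yy addrAC subrr add0r.
    rewrite (_ : cross _ _ = h) => [/lt_geF|]; first by rewrite ltW.
    by rewrite -[RHS]mulr1 -T1 /cross /rot90 /= /GRing.scale /=; ring.
  rewrite divr_gt0 ?addr_gt0//= ltr_pdivrMr ?addr_gt0// mul1r ltrDl//.
have [s0|s0] := eqVneq (dot T (z - g a)) 0; first exact: behind z Kz s0 zneg.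
pose s := dot T (z - g a); pose k := - cross T (z - g a).
have k0 : 0 < k by rewrite oppr_gt0.
(* In the frame of [T] and [rot90 T] at [g a], the curve has coordinates [phi], [psi], and [z] has
   coordinates [s], [- k]. Then [s * psi t + k * phi t] is the cross product of [z - g a] and
   [g t - g a]. *)
pose phi t := T.1 * ((g t).1 - (g a).1) + T.2 * ((g t).2 - (g a).2).
pose psi t := T.1 * ((g t).2 - (g a).2) - T.2 * ((g t).1 - (g a).1).
have dX := is_derive_fst _ _ (curve_derivable a).
have dY := is_derive_snd _ _ (curve_derivable a).
have dphi : is_derive a 1 phi 1.
  have := is_derive_affine _ _ T.1 (g a).1 T.2 (g a).2 _ _ _ dX dY.
  by rewrite -/T -!expr2 T1.
have dF : is_derive a 1 (fun t => s * psi t + k * phi t) k.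
  have := is_derive_affine _ _ (- s * T.2 + k * T.1) (g a).1 (s * T.1 + k * T.2)
    (g a).2 _ _ _ dX dY.
  rewrite (_ : (fun s0 => _ + _) = (fun t => s * psi t + k * phi t)); last first.
    by apply/funext => t; rewrite /psi /phi; ring.
  suff -> : (- s * T.2 + k * T.1) * T.1 + (s * T.1 + k * T.2) * T.2 = k by [].
  by rewrite -[RHS]mulr1 -T1; ring.
have phi0 : phi a = 0 by rewrite /phi !subrr !mulr0 addr0.
have psi0 : psi a = 0 by rewrite /psi !subrr !mulr0 subrr.
have F0 : s * psi a + k * phi a = 0 by rewrite phi0 psi0 !mulr0 addr0.
have N1 := is_derive_sign _ _ _ dphi phi0 ltr01.
have N2 := is_derive_sign _ _ _ dF F0 k0.
(* With [h] of sign opposite to [s], the points [g (a + h)] and [z] are on different sides of the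
   normal line. *)
have [h [sh h1 h2]] : exists h, [/\ s * h < 0, 0 < h * phi (a + h)
    & 0 < h * (s * psi (a + h) + k * phi (a + h))].
  have [sp|sn] : 0 < s \/ s < 0.
    by case: (ltgtP s 0) s0 => // ? _; [right|left].
  - near (0 : R)^'- => h.
    have h0 : h < 0 by near: h; exact: nbhs_left_lt.
    exists h; split; first by rewrite pmulr_rlt0.
      by near: h; exact: dnbhs_at_left N1.
    by near: h; exact: dnbhs_at_left N2.
  - near (0 : R)^'+ => h.
    have h0 : 0 < h by near: h; exact: nbhs_right_gt.
    exists h; split; first by rewrite nmulr_rlt0.
      by near: h; exact: dnbhs_at_right N1.
    by near: h; exact: dnbhs_at_right N2.
set u1 := phi (a + h) in h1 h2; set u2 := psi (a + h) in h2.
have su1 : s * u1 < 0 by nra.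
have Fu : 0 < u1 * (s * u2 + k * u1) by nra.
have us0 : u1 - s != 0 by apply/eqP; nra.
(* The parameter at which the chord from [g (a + h)] to [z] crosses the normal line, where
   [(1 - l) * u1 + l * s] vanishes. *)
pose l := u1 / (u1 - s).
have l01 : 0 < l < 1.
  rewrite /l; have [up|un|u0] := ltgtP 0 u1.
  - have us : 0 < u1 - s by nra.
    by rewrite divr_gt0//= ltr_pdivrMr//; nra.
  - have us : u1 - s < 0 by nra.
    by rewrite nmulr_rgt0// invr_lt0 us/= ltr_ndivrMr//; nra.
  - by move: su1; rewrite -u0 mulr0 ltxx.
pose y := (1 - l) *: g (a + h) + l *: z.
have Ky : K° y.
  apply: sc => //; first by have [] := gK (a + h).
  apply/eqP => gz; move: su1; rewrite /s -gz -[dot _ _]/(phi (a + h)) -/u1.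
  by rewrite -expr2 ltNge sqr_ge0.
have dotE : dot T (y - g a) = (1 - l) * u1 + l * s.
  by rewrite /y /u1 /phi /s /dot /= /GRing.scale /=; ring.
have crossE : cross T (y - g a) = (1 - l) * u2 - l * k.
  by rewrite /y /u2 /psi /k /cross /= /GRing.scale /=; ring.
apply: (behind y); first exact: interior_subset.
  by rewrite dotE /l; field.
rewrite crossE (_ : _ - _ = - (u1 * (s * u2 + k * u1)) / (u1 * (u1 - s))).
  rewrite mulNr oppr_lt0 divr_gt0//; nra.
by rewrite /l; field; rewrite us0/=; apply/eqP; nra.
Unshelve. all: by end_near. Qed.
End Curve.

(** Let [p], [q] be parallel vectors from the first point to the other two; the arguments are their
    cross products with the tangents at the three points. The first two signs put both points on one
    ray. If [p] is not the longer one, the signs at the second point contradict this, otherwise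
    those at the third. *)
Lemma no_common_side {R : realType} (pa qa pb qb pc qc : R) :
  0 < pa -> 0 < qa -> 0 < - pb -> 0 < qb - pb -> 0 < - qc -> 0 < pc - qc ->
  pa * qb = qa * pb -> pa * qc = qa * pc -> False.
Proof.
move=> A1 A2 B1 B2 C1 C2 KB KC; have [h|h] := leP pa qa.
  have : pb * qa <= pb * pa by rewrite ler_nM2l; lra.
  have : pa * pb < pa * qb by rewrite ltr_pM2l; lra.
  lra.
have : qa * pc > qa * qc by rewrite ltr_pM2l; lra.
have : qa * qc > pa * qc by rewrite ltr_nM2r; lra.
lra.
Qed.

Section ConvexCurve.
Context {R : realType} {g : R -> R * R} (hg : strictly_convex_unit_curve g).

Lemma curve_periodic_int (m : int) (t : R) : g (t + m%:~R) = g t.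
Proof.
have gP : periodic g 1 by case: hg.
have gn (n : nat) s : g (s + n%:R) = g s.
  by elim: n s => [|n IH] s; rewrite ?addr0// -natr1 addrA gP IH.
case: m => n; first exact: gn.
by rewrite NegzE mulrNz -[in RHS](subrK n.+1%:R t) gn.
Qed.

Lemma curve_inj (a c : R) : a < c -> c < a + 1 -> g a <> g c.
Proof.
move=> ac ca; have ginj : {in `[0, 1[ &, injective g} by case: hg.
have fr t : t + (- Num.floor t)%:~R \in (`[0, 1[ : set R).
  rewrite inE /= in_itv /= mulrNz subr_ge0 floor_le /= ltrBlDr addrC -[1]/(1%:~R) -intrD.
  by rewrite floorD1_gt.
rewrite -(curve_periodic_int (- Num.floor a) a) -(curve_periodic_int (- Num.floor c) c).
move=> /(ginj _ _ (fr a) (fr c)); rewrite !mulrNz => e.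
have e1 : c - a = (Num.floor c - Num.floor a)%:~R.
  by rewrite intrB; lra.
have : 0 < ((Num.floor c - Num.floor a)%:~R : R) < 1 by rewrite -e1; lra.
rewrite ltr0z -[1]/(1%:~R) ltr_int => /andP[h1]; rewrite -[1]add0r ltzD1.
by move=> h2; have := lt_le_trans h1 h2; rewrite ltxx.
Qed.

(** Strictness on top of [tangent_support]: if [z] were on the tangent at [g a], the midpoint of [z]
    and [g a] would be interior and on the tangent, so that [K] would have points beyond it. *)
Lemma strictly_convex_region : exists K : set (R * R),
  [/\ strictly_convex_set K, forall t, K (g t), forall t, ~ K° (g t) &
  forall a z, K z -> z != g a -> 0 < cross (g^`() a) (z - g a)].
Proof.
have half01 : 0 < (2^-1 : R) < 1 by lra.
have [K [cK sc bd inw]] : exists K : set (R * R),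
  [/\ compact K, strictly_convex_set K, range g = K `\` K° &
   forall t, \forall h \near 0^'+, K° (g t + h *: rot90 (g^`() t))] by case: hg.
have gK t : K (g t) /\ ~ K° (g t).
  by have : range g (g t) by [exists t]; rewrite bd.
exists K; split => // [t|t|a z Kz za]; [by case: (gK t)|by case: (gK t)|].
have sup y : K y -> 0 <= cross (g^`() a) (y - g a).
  by move=> Ky; apply: (tangent_support hg K).
rewrite lt_neqAle sup// andbT eq_sym; apply/eqP => z0.
pose m := (1 - 2^-1) *: z + 2^-1 *: g a.
have Km : K° m by exact: sc Kz (gK a).1 za half01.
have T1 := tangent_sqr hg a; set T := g^`() a in T1 z0 sup *.
have m0 : cross T (m - g a) = 0.
  by rewrite -[RHS](mulr0 (1 - 2^-1)) -z0 /m /cross /= /GRing.scale /=; ring.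
have fC : continuous (fun h : R => m - h *: rot90 T).
  by move=> h; apply: cvgB; [exact: cvg_cst|apply: cvgZl; exact: cvg_id].
have near0 : \forall h \near (0 : R), K (m - h *: rot90 T).
  have := fC 0; rewrite /continuous_at scale0r subr0 => /(_ _ Km) /=.
  by [].
have [h [h0 Kh]] : exists h : R, 0 < h /\ K (m - h *: rot90 T).
  near (0 : R)^'+ => h; exists h; split; first by near: h; exact: nbhs_right_gt.
  by near: h; apply: cvg_within; exact: near0.
have := sup _ Kh.
rewrite (_ : cross _ _ = cross T (m - g a) - h).
  by rewrite m0 sub0r oppr_ge0 leNgt h0.
by rewrite -[h in RHS]mulr1 -T1 /cross /= /GRing.scale /=; ring.
Unshelve. all: by end_near. Qed.

Lemma tangent_cross_gt0 (a c : R) : a < c -> c < a + 1 ->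
  0 < cross (g^`() a) (g c - g a).
Proof.
move=> ac ca; have [K [_ gK _]] := strictly_convex_region; apply => //.
by apply/eqP => e; exact: (curve_inj _ _ ac ca (esym e)).
Qed.

Lemma tangent_cross_gt0_before (a c : R) : a < c -> c < a + 1 ->
  0 < cross (g^`() c) (g a - g c).
Proof.
move=> ac ca; rewrite -(curve_periodic_int 1 a).
by apply: tangent_cross_gt0 => //; lra.
Qed.

(* Seen from each of three collinear points, the other two would lie on the
   same side. *)
Lemma curve_not_collinear (a b c : R) : a < b -> b < c -> c < a + 1 ->
  cross (g b - g a) (g c - g a) != 0.
Proof.
move=> ab bc ca; apply/eqP.
have ac : a < c by lra.
have ba : b < a + 1 by lra.
have cb : c < b + 1 by lra.
have A1 := tangent_cross_gt0 _ _ ab ba; have A2 := tangent_cross_gt0 _ _ ac ca.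
have B1 := tangent_cross_gt0_before _ _ ab ba.
have B2 := tangent_cross_gt0 _ _ bc cb.
have C1 := tangent_cross_gt0_before _ _ ac ca.
have C2 := tangent_cross_gt0_before _ _ bc cb.
set p := g b - g a; set q := g c - g a => pq0.
have KB := cross_parallel (g^`() a) (g^`() b) _ _ pq0.
have KC := cross_parallel (g^`() a) (g^`() c) _ _ pq0.
have pq : q - p = g c - g b by rewrite /p /q opprB addrA subrK.
rewrite -opprB -/p crossNr in B1; rewrite -pq crossBr in B2.
rewrite -opprB -/q crossNr in C1; rewrite -opprB -pq opprB crossBr in C2.
exact: (no_common_side _ _ _ _ _ _ A1 A2 B1 B2 C1 C2 KB KC).
Qed.

(** As a function of [b], the cross product is positive just after [a], because the tangent there
    has [g c] on its left. It cannot vanish before [c] since no three points are collinear, so it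
    keeps its sign. *)
Lemma curve_orientation (a b c : R) : a < b -> b < c -> c < a + 1 ->
  0 < cross (g b - g a) (g c - g a).
Proof.
move=> ab bc ca; set q := g c - g a.
pose f t := q.2 * ((g t).1 - (g a).1) + - q.1 * ((g t).2 - (g a).2).
have fE t : f t = cross (g t - g a) q by rewrite /f /cross /=; ring.
have df (s : R) : is_derive s 1 f (q.2 * (g^`() s).1 + - q.1 * (g^`() s).2).
  apply: is_derive_affine; [apply: is_derive_fst|apply: is_derive_snd];
  exact: (curve_derivable hg).
have fa0 : f a = 0 by rewrite /f !subrr !mulr0 addr0.
have dfa : 0 < q.2 * (g^`() a).1 + - q.1 * (g^`() a).2.
  have := tangent_cross_gt0 a c; rewrite -/q /cross => /(_ _ _)/=.
  by move=> h; apply: lt_le_trans (h _ _) _; lra.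
have N := is_derive_sign _ _ _ (df a) fa0 dfa.
have [e [e0 eb fe]] : exists e, [/\ 0 < e, a + e < b & 0 < f (a + e)].
  near (0 : R)^'+ => e.
  have e0 : 0 < e by near: e; exact: nbhs_right_gt.
  exists e; split => //.
    suff : e < b - a by lra.
    by near: e; apply: nbhs_right_lt; rewrite subr_gt0.
  by rewrite -(pmulr_rgt0 _ e0); near: e; exact: dnbhs_at_right N.
have nz t : a < t -> t < c -> f t != 0.
  by move=> at0 tc; rewrite fE; exact: curve_not_collinear.
rewrite -fE lt_neqAle eq_sym nz//= leNgt; apply/negP => fb.
have [||t] := @IVT R f (a + e) b 0 (ltW eb).
- apply: continuous_subspaceT => s; exact: is_derive_continuous (df s).
- by rewrite ge_min (ltW fb) orbT le_max (ltW fe).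
rewrite in_itv /= => /andP[t1 t2] ft0.
by have := nz t; rewrite ft0 eqxx => /(_ _ _)/negP; apply => //; lra.
Unshelve. all: by end_near. Qed.

End ConvexCurve.

(** * Chord lengths and the reflection law *)

Definition chord {R : realType} (g : R -> R * R) (a b : R) : R := enorm (g b - g a).

Lemma chordC {R : realType} (g : R -> R * R) (a b : R) : chord g a b = chord g b a.
Proof. exact: enormB. Qed.

Lemma chord_ge0 {R : realType} (g : R -> R * R) (a b : R) : 0 <= chord g a b.
Proof. exact: enorm_ge0. Qed.

Lemma chordxx {R : realType} (g : R -> R * R) (a : R) : chord g a a = 0.
Proof. by rewrite /chord subrr enorm0. Qed.

(** Equal cosines with [T] give sines of equal square, and both sines are positive; so [v] and [w]
    have the same direction. *)
Lemma cross_eq0_direction {R : realType} (T v w : R * R) :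
  T.1 ^+ 2 + T.2 ^+ 2 = 1 -> 0 < cross T v -> 0 < cross T w ->
  dot T v / enorm v = dot T w / enorm w -> cross v w = 0.
Proof.
move=> T1 v0 w0 h.
have nz (u : R * R) : 0 < cross T u -> 0 < enorm u.
  move=> u0; apply: enorm_gt0; apply: contraTneq u0 => ->.
  by rewrite /cross /= !mulr0 subrr ltxx.
have sq (u : R * R) : cross T u ^+ 2 = enorm u ^+ 2 - dot T u ^+ 2.
  by rewrite enorm_sqr -[X in X - _]mul1r -T1 /cross /dot; ring.
have -> : cross v w = dot T v * cross T w - cross T v * dot T w.
  by rewrite -[LHS]mul1r -T1 /cross /dot; ring.
have nv := nz _ v0; have nw := nz _ w0.
set r := dot T v / enorm v in h.
have dv : dot T v = r * enorm v by rewrite /r divfK// gt_eqF.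
have dw : dot T w = r * enorm w by rewrite h divfK// gt_eqF.
have e : cross T v * enorm w = cross T w * enorm v.
  apply/eqP; rewrite -(@eqrXn2 _ 2)//; try by rewrite mulr_ge0// ltW.
  by rewrite !exprMn !sq dv dw; apply/eqP; ring.
rewrite dv dw (_ : _ - _ = r * (cross T w * enorm v - cross T v * enorm w)).
  by rewrite e subrr mulr0.
by move: {h dv dw} r => r; ring.
Qed.

Section Chords.
Context {R : realType} {g : R -> R * R} (hg : strictly_convex_unit_curve g).

Lemma chordSr (a b : R) : chord g a (b + 1) = chord g a b.
Proof. by rewrite /chord -[1]/(1%:~R) (curve_periodic_int hg). Qed.

Lemma chordSl (a b : R) : chord g (a + 1) b = chord g a b.
Proof. by rewrite chordC chordSr chordC. Qed.

Lemma chord_gt0 (a b : R) : a < b -> b < a + 1 -> 0 < chord g a b.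
Proof.
move=> ab ba; apply: enorm_gt0; rewrite subr_eq0 eq_sym; apply/eqP.
exact: (curve_inj hg).
Qed.

(** If [b = c] or [d = a + 1], the quadrilateral collapses to a triangle or a segment, and the
    triangle inequality or the positivity of a chord takes over. *)
Lemma chord_quad_lt (a b c d : R) : a < b -> b <= c -> c < d -> d <= a + 1 ->
  chord g a d + chord g b c < chord g a c + chord g b d.
Proof.
move=> ab bc cd da.
have [e|ne] := eqVneq b c.
  subst c; rewrite chordxx addr0.
  have [e|ne] := eqVneq d (a + 1).
    by rewrite e chordSr chordxx ltr_wpDr ?chord_ge0// chord_gt0//; lra.
  have {}da : d < a + 1 by rewrite lt_neqAle ne.
  rewrite [X in _ < X]addrC /chord -[g d - g a](subrKA (g b)); apply: enorm_triangle_lt.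
  rewrite (_ : cross _ _ = - cross (g b - g a) (g d - g a)).
    by rewrite oppr_eq0 (curve_not_collinear hg).
  by rewrite /cross /=; ring.
have {}bc : b < c by rewrite lt_neqAle ne.
have [e|ned] := eqVneq d (a + 1).
  rewrite e !chordSr chordxx add0r /chord.
  rewrite -[g c - g b](subrKA (g a)); apply: enorm_triangle_lt.
  rewrite (_ : cross _ _ = cross (g b - g a) (g c - g a)).
    by rewrite (curve_not_collinear hg)//; lra.
  by rewrite /cross /=; ring.
have {}da : d < a + 1 by rewrite lt_neqAle ned.
by apply: quadrilateral_lt; apply: (curve_orientation hg); lra.
Qed.

Lemma chord_quad (a b c d : R) : a <= b -> b <= c -> c <= d -> d <= a + 1 ->
  chord g a d + chord g b c <= chord g a c + chord g b d.
Proof.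
rewrite le_eqVlt => /predU1P[-> _ _ _|ab bc]; first by rewrite addrC.
rewrite le_eqVlt => /predU1P[-> _|cd da]; first exact: lexx.
exact/ltW/chord_quad_lt.
Qed.

Lemma is_derive_chord (a b : R) : g b != g a ->
  is_derive b 1 (chord g a) (dot (g^`() b) (g b - g a) / chord g a b).
Proof.
move=> nba.
pose f t := (g t).1 - (g a).1; pose h t := (g t).2 - (g a).2.
have df : is_derive b 1 f (g^`() b).1.
  have := is_deriveB (is_derive_fst _ _ (curve_derivable hg b))
    (is_derive_cst (g a).1 b 1).
  by rewrite subr0.
have dh : is_derive b 1 h (g^`() b).2.
  have := is_deriveB (is_derive_snd _ _ (curve_derivable hg b))
    (is_derive_cst (g a).2 b 1).
  by rewrite subr0.
pose N := f ^+ 2 + h ^+ 2.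
have dN := is_deriveD (is_deriveX 2 df) (is_deriveX 2 dh).
have nba0 : g b - g a != 0 by rewrite subr_eq0.
have cb := enorm_gt0 _ nba0.
have Nb : 0 < N b by move: cb; rewrite /enorm sqrtr_gt0.
have := is_derive1_comp (is_derive1_sqrt Nb) dN.
suff -> : (2 * Num.sqrt (N b))^-1 *
  ((2%:R * f b ^+ 1) *: (g^`() b).1 + (2%:R * h b ^+ 1) *: (g^`() b).2)
  = dot (g^`() b) (g b - g a) / chord g a b by [].
have -> : Num.sqrt (N b) = chord g a b by [].
rewrite /dot /f /h /GRing.scale /= !expr1; field.
by rewrite gt_eqF.
Qed.

(** The sum of the distances to [g a] and [g c] is stationary at [b]; its derivative is the
    difference of the two cosines. *)
Lemma reflection_law (a b c : R) : a < b -> b < a + 1 -> b < c -> c < b + 1 ->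
  (forall t, a <= t -> t <= c -> t <= a + 1 -> c <= t + 1 ->
    chord g a t + chord g t c <= chord g a b + chord g b c) ->
  dot (g^`() b) (g b - g a) / chord g a b =
  dot (g^`() b) (g c - g b) / chord g b c.
Proof.
move=> ab ba bc cb bmax.
(* Between [l] and [u] both chords are nondegenerate, hence differentiable, and [t] is admissible in
   the maximality hypothesis. *)
pose l := Num.max a (c - 1); pose u := Num.min c (a + 1).
pose F t := chord g a t + chord g c t.
have lu t : t \in `]l, u[%R -> [/\ a < t, t < a + 1, t < c & c < t + 1].
  by rewrite in_itv /= gt_max lt_min => /andP[/andP[? ?] /andP[? ?]]; split; lra.
have neq s t : s < t -> t < s + 1 -> g s != g t.
  by move=> st ts; apply/eqP; exact: (curve_inj hg).
have dF t : t \in `]l, u[%R -> is_derive t 1 F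
    (dot (g^`() t) (g t - g a) / chord g a t + dot (g^`() t) (g t - g c) / chord g c t).
  move=> /lu[t1 t2 t3 t4]; apply: is_deriveD; apply: is_derive_chord.
    by rewrite eq_sym neq.
  by rewrite neq.
have blu : b \in `]l, u[%R by rewrite in_itv /= gt_max lt_min; lra.
have lu0 : l <= u by move: blu; rewrite in_itv /= => /andP[h1 h2]; lra.
have F0 : is_derive b 1 F 0.
  apply: (derive1_at_max lu0) blu _ => [t /dF[]//|t /lu[t1 t2 t3 t4]].
  by rewrite /F ![chord g c _]chordC; apply: bmax; lra.
case: (dF b blu) => _; case: F0 => _ ->.
rewrite -[g b - g c]opprB [chord g c b]chordC => e.
have -> : dot (g^`() b) (g c - g b) = - dot (g^`() b) (- (g c - g b)).
  by rewrite /dot /=; ring.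
by rewrite mulNr; lra.
Qed.

(** The cosine fixes the direction of the chord on the inner side of the tangent, and a ray from
    [g b] meets the curve in only one further point. *)
Lemma reflection_unique (b c c' r : R) : b < c -> c < b + 1 -> b < c' -> c' < b + 1 ->
  dot (g^`() b) (g c - g b) / chord g b c = r ->
  dot (g^`() b) (g c' - g b) / chord g b c' = r -> c = c'.
Proof.
move=> bc cb bc' cb' h h'.
have e := cross_eq0_direction _ _ _ (tangent_sqr hg b)
  (tangent_cross_gt0 hg _ _ bc cb) (tangent_cross_gt0 hg _ _ bc' cb') 
  (etrans h (esym h')).
case: (ltgtP c c') => // cc.
  by have := curve_orientation hg _ _ _ bc cc cb'; rewrite e ltxx.
have := curve_orientation hg _ _ _ bc' cc cb.
by rewrite crossC e oppr0 ltxx.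
Qed.

End Chords.

(** * Rotation sequences and longest polygons *)

(* Polygons are extended periodically, so that they can be read off starting from
   any vertex. *)
Definition rotation_sequence {R : realType} (p n : nat) (x : nat -> R) : Prop :=
  (forall i, x (i + n)%N = x i + p%:R) /\ (forall i, x i <= x i.+1 <= x i + 1).

Section RotationSequences.
Context {R : realType}.
Implicit Types (p n i k : nat) (x : nat -> R).

Lemma rotation_sequenceM p n x i k : rotation_sequence p n x ->
  x (i + k * n)%N = x i + (k * p)%:R.
Proof.
move=> [xp _]; elim: k => [|k IH]; first by rewrite !mul0n addn0 addr0.
by rewrite mulSn addnCA addnC xp IH mulSn natrD -addrA [_ + p%:R]addrC.
Qed.

Lemma rotation_sequence_shift p n x k : rotation_sequence p n x ->
  rotation_sequence p n (fun i => x (i + k)%N).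
Proof. by move=> [xp xs]; split=> i; rewrite ?addSn// addnAC xp. Qed.

Lemma rotation_sequence_le p n x i k : rotation_sequence p n x ->
  (i <= k)%N -> x i <= x k.
Proof.
move=> [_ xs] /subnKC <-; elim: (k - i)%N => [|d IH]; first by rewrite addn0.
by rewrite addnS; apply: le_trans IH _; case/andP: (xs (i + d)%N).
Qed.

Lemma rotation_sequence_leD p n x i k : rotation_sequence p n x ->
  x (i + k)%N <= x i + k%:R.
Proof.
move=> [_ xs]; elim: k => [|k IH]; first by rewrite addn0 addr0.
have /andP[_ h] := xs (i + k)%N.
by rewrite addnS -natr1 addrA; lra.
Qed.

Lemma inscribed_rotation_sequence p n x : (0 < n)%N -> inscribed_polygon p n x ->
  exists2 z, rotation_sequence p n z & forall i, (i <= n)%N -> z i = x i.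
Proof.
move=> n0 [xn xs].
pose z i := x (i %% n)%N + ((i %/ n) * p)%:R.
(* The case [r = n] is included so that the step across the end of a period needs no separate
   treatment. *)
have zE k r : (r <= n)%N -> z (r + k * n)%N = x r + (k * p)%:R.
  rewrite leq_eqVlt => /predU1P[->|rn].
    rewrite -mulSn /z modnMl mulnK// xn mulSn natrD; lra.
  by rewrite /z addnC modnMDl modn_small// divnMDl// divn_small// addn0.
have iE i : i = (i %% n + i %/ n * n)%N by rewrite addnC -divn_eq.
exists z; last by move=> i lin; rewrite -[in LHS](addn0 i) -(mul0n n) zE// mul0n addr0.
have lt_mod i := ltn_pmod i n0.
split=> i; rewrite (iE i); have le_mod := ltnW (lt_mod i).
  by rewrite -addnA -mulSnr !zE// mulSnr natrD addrA.
rewrite -addSn !zE//.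
by have /andP[? ?] := xs _ (lt_mod i); apply/andP; split; lra.
Qed.

(* [x] has fewer vertices per turn than [y], so some arc of [x] contains two
   consecutive points of [y]; it is taken with the first such point. *)
Lemma exists_nested_arc p m x y : (0 < p)%N -> (0 < m)%N ->
  rotation_sequence p m x -> rotation_sequence p m.+2 y ->
  exists i k, [/\ x i <= y k, y k.+1 <= x i.+1 & y (k + m.+1)%N < x (i + m)%N].
Proof.
move=> p0 m0 hx hy; apply: contrapT => no.
have archi (r : R) : exists M : nat, r < M%:R.
  exists (Num.bound `|r|); apply: le_lt_trans (ler_norm _) _.
  exact: archi_boundP.
have unb n u (r : R) : rotation_sequence p n u -> exists i, r < u i.
  move=> hu; have [M hM] := archi (r - u 0%N); exists (0 + M * n)%N.
  rewrite (rotation_sequenceM _ _ _ _ _ hu) -ltrBlDl; apply: lt_le_trans hM _.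
  by rewrite ler_nat leq_pmulr.
have [i0 hi0] := unb _ _ (y 0%N) hx.
have [k0 hk0] : exists k, y k < x i0 <= y k.+1.
  have ex : exists k, x i0 <= y k.
    by have [k /ltW hk] := unb _ _ (x i0) hy; exists k.
  case: (@ex_minnP (fun k => x i0 <= y k) ex) => -[|k] hk kmin.
    by move: hi0; rewrite ltNge hk.
  exists k; rewrite hk andbT ltNge; apply/negP => /kmin; by rewrite ltnn.
(* Without a nested arc, each step of [x] passes at most one point of [y]. *)
have key t : exists2 k, (k <= k0 + t)%N & y k < x (i0 + t)%N <= y k.+1.
  elim: t => [|t [k hk /andP[h1 h2]]]; first by exists k0; rewrite !addn0.
  have h3 : x (i0 + t).+1 < y k.+2.
    rewrite ltNge; apply/negP => h; apply: no; exists (i0 + t)%N, k.+1; split => //.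
    (* The third condition is [y k < x (i0 + t)], moved on by one period. *)
    by case: hx hy => xp _ [yp _]; rewrite addSnnS yp xp ltrD2r.
  have h4 : x (i0 + t)%N <= x (i0 + t).+1 by case: hx => _ /(_ (i0 + t)%N)/andP[].
  rewrite !addnS; have [h|h] := leP (x (i0 + t).+1) (y k.+1).
    by exists k; [exact: leqW|rewrite h (lt_le_trans h1 h4)].
  by exists k.+1; [|rewrite h ltW].
have [M hM] := archi (y k0.+1 - x i0).
(* After this common multiple of both periods [x] has advanced by [M * m.+2 * p], but [y] by only
   [M * m * p]; the gap is at least [M]. *)
have [k hk /andP[_ h]] := key (M * m.+2 * m)%N.
have := le_trans h (rotation_sequence_le _ _ _ _ _ hy (hk : (k.+1 <= (k0 + _).+1)%N)).
rewrite -addSn (rotation_sequenceM _ _ _ _ _ hx).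
have -> : (M * m.+2 * m = M * m * m.+2)%N by lia.
rewrite (rotation_sequenceM _ _ _ _ _ hy).
have : (M * m.+2 * p)%:R = (M * m * p)%:R + (M * (2 * p))%:R :> R.
  by rewrite -natrD; congr _%:R; nia.
have : M%:R <= (M * (2 * p))%:R :> R by rewrite ler_nat; nia.
lra.
Qed.

End RotationSequences.

(** * Longest polygons and their nondegeneracy *)

Definition longest {R : realType} (g : R -> R * R) (p n : nat) (x : nat -> R) : Prop :=
  rotation_sequence p n x /\ perimeter g n x = max_perimeter g p n.

Lemma perimeter_ext {R : realType} (g : R -> R * R) (n : nat) (x y : nat -> R) :
  (forall i, (i <= n)%N -> x i = y i) -> perimeter g n x = perimeter g n y.
Proof. by move=> xy; apply: eq_bigr => i _; rewrite !xy// ltnW. Qed.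

Lemma sum_shift_periodic {R : realType} (f : nat -> R) (n k : nat) :
  (forall i, f (i + n)%N = f i) -> \sum_(i < n) f (i + k)%N = \sum_(i < n) f i.
Proof.
move=> fn; elim: k => [|k <-]; first by apply: eq_bigr => i _; rewrite addn0.
have e : \sum_(i < n.+1) f (i + k)%N = \sum_(i < n.+1) f (i + k)%N by [].
rewrite [LHS]big_ord_recl [RHS]big_ord_recr /= add0n [(n + k)%N]addnC fn [RHS]addrC in e.
by rewrite -(addrI _ e); apply: eq_bigr => i _; rewrite /bump /= add1n addSnnS.
Qed.

Section LongestPolygons.
Context {R : realType} {g : R -> R * R} (hg : strictly_convex_unit_curve g).
Implicit Types (p n i k : nat) (x y z : nat -> R).

Lemma le_max_perimeter p n x : (p <= n)%N -> inscribed_polygon p n x ->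
  perimeter g n x <= max_perimeter g p n.
Proof.
move=> pn hx; have gP : periodic g 1 by case: hg.
by have [z [_ -> zmax]] := max_perimeterP (curve_continuous hg) gP pn; exact: zmax.
Qed.

Lemma longest_ext p n x : (0 < n)%N -> inscribed_polygon p n x ->
  perimeter g n x = max_perimeter g p n ->
  exists2 z, longest g p n z & forall i, (i <= n)%N -> z i = x i.
Proof.
move=> n0 /(inscribed_rotation_sequence _ _ _ n0)[z hz zx] xmax; exists z => //.
by split=> //; rewrite -xmax; exact: perimeter_ext.
Qed.

Lemma exists_longest p n : (0 < n)%N -> (p <= n)%N -> exists x, longest g p n x.
Proof.
move=> n0 pn; have gP : periodic g 1 by case: hg.
have [x [hx xmax _]] := max_perimeterP (curve_continuous hg) gP pn.
by have [z hz _] := longest_ext _ _ _ n0 hx (esym xmax); exists z.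
Qed.

Lemma longest_shift p n x k : longest g p n x -> longest g p n (fun i => x (i + k)%N).
Proof.
move=> [hx xmax]; split; first exact: rotation_sequence_shift.
rewrite -xmax; apply: (sum_shift_periodic (fun i => chord g (x i) (x i.+1))) => i.
case: hx => xp _; rewrite -addSn !xp /chord -[p%:R]/((Posz p)%:~R).
by rewrite !(curve_periodic_int hg).
Qed.

(** A shift gives the middle vertex index 1, away from both ends, so that moving it alone leaves a
    closed polygon. *)
Lemma longest_local p n x i (t : R) : (1 < n)%N -> (p <= n)%N -> longest g p n x ->
  x i <= t -> t <= x i.+2 -> t <= x i + 1 -> x i.+2 <= t + 1 ->
  chord g (x i) t + chord g t (x i.+2) <=
  chord g (x i) (x i.+1) + chord g (x i.+1) (x i.+2).
Proof.
case: n => [|[|n]]// _ pn /(longest_shift _ _ _ i)[].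
set u := fun j => _ => -[up us] umax.
rewrite -[x i]/(u 0%N) -[x i.+1]/(u 1%N) -[x i.+2]/(u 2%N) => t1 t2 t3 t4.
pose v j := if j == 1%N then t else u j.
have hv : inscribed_polygon p n.+2 v.
  split; first by rewrite /v /= -[n.+2]add0n up.
  move=> j _; rewrite /v; case: j => [|[|j]] /=; apply/andP.
  - by split; lra.
  - by split; lra.
  - by have /andP[? ?] := us j.+2; split; lra.
have := le_max_perimeter _ _ _ pn hv; rewrite -umax /perimeter.
by rewrite 4!big_ord_recl /v /= -![enorm (g _ - g _)]/(chord g _ _) !addrA lerD2r.
Qed.

Section Nondegenerate.
Context {p n : nat} {x : nat -> R} (p0 : (0 < p)%N) (pn : (p < n)%N).
Context (hx : longest g p n x).

Let n1 : (1 < n)%N := leq_ltn_trans p0 pn.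

(** If a vertex is repeated and the next side is not degenerate, moving the second copy into the
    next arc lengthens the polygon. So one repetition makes all steps zero, against [0 < p]. *)
Lemma longest_lt i : x i < x i.+1.
Proof.
have [[xp xs] _] := hx.
rewrite lt_neqAle; have /andP[-> _] := xs i; rewrite andbT; apply/eqP => e.
have const k : x (i + k)%N = x (i + k).+1.
  elim: k => [|k IH]; first by rewrite addn0.
  rewrite addnS; move: IH; move: (i + k)%N => j ej.
  apply/eqP; rewrite eq_le; have /andP[h1 h2] := xs j.+1; rewrite h1/= leNgt.
  apply/negP => h; rewrite -ej in h h1 h2.
  pose t := (x j + x j.+2) / 2.
  have := longest_local p n x j t n1 (ltnW pn) hx; rewrite -ej chordxx add0r.
  have h3 : x j < t by rewrite /t; lra.
  have h4 : t < x j.+2 by rewrite /t; lra.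
  have := chord_quad_lt hg _ _ _ _ h3 (lexx t) h4 h2; rewrite chordxx addr0.
  move=> h5 h6; have := h6 (ltW h3) (ltW h4); lra.
have cst k : x (i + k)%N = x i.
  by elim: k => [|k <-]; rewrite ?addn0// addnS.
have := cst n; rewrite xp => h.
have : 0 < p%:R :> R by rewrite ltr0n.
lra.
Qed.

(** A full turn is also a side of length zero. By the same argument, with [x j.+2 - 1] in place of
    [x j.+2], one full turn makes all steps full turns, against [p < n]. *)
Lemma longest_lt1 i : x i.+1 < x i + 1.
Proof.
have [[xp xs] _] := hx.
rewrite lt_neqAle; have /andP[_ ->] := xs i; rewrite andbT; apply/eqP => e.
have const k : x (i + k).+1 = x (i + k)%N + 1.
  elim: k => [|k IH]; first by rewrite addn0.
  rewrite addnS; move: IH; move: (i + k)%N => j ej.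
  apply/eqP; rewrite eq_le; have /andP[h1 h2] := xs j.+1; rewrite h2/= leNgt.
  apply/negP => h; rewrite ej in h h1 h2.
  pose t := (x j + x j.+2) / 2.
  have := longest_local p n x j t n1 (ltnW pn) hx.
  rewrite ej (chordSr hg (x j) (x j)) chordxx add0r (chordSl hg (x j)).
  have h3 : x j.+2 - 1 < t by rewrite /t; lra.
  have h4 : t < x j + 1 by rewrite /t; lra.
  have h7 : x j + 1 <= x j.+2 - 1 + 1 by lra.
  have := chord_quad_lt hg _ _ _ _ h3 (lexx t) h4 h7; rewrite chordxx addr0 !(chordSr hg).
  have -> : chord g (x j.+2 - 1) (x j) = chord g (x j) (x j.+2).
    by rewrite -(chordSl hg) subrK chordC.
  have -> : chord g (x j.+2 - 1) t = chord g t (x j.+2).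
    by rewrite -(chordSl hg) subrK chordC.
  rewrite [chord g t (x j)]chordC => h5 h6.
  by have := h6 _ _ _ _; lra.
have all k : x (i + k)%N = x i + k%:R.
  by elim: k => [|k IH]; rewrite ?addn0 ?addr0// addnS const IH -natr1 addrA.
have := all n; rewrite xp => /addrI/eqP; rewrite eqr_nat => /eqP e'.
by move: pn; rewrite e' ltnn.
Qed.

End Nondegenerate.

(** The reflection law at the middle vertex involves only its two neighbours, so the two polygons
    may differ in type. *)
Lemma longest_determined p n x p' n' z i k :
  (0 < p)%N -> (p < n)%N -> longest g p n x ->
  (0 < p')%N -> (p' < n')%N -> longest g p' n' z ->
  x i = z k -> x i.+1 = z k.+1 -> x i.+2 = z k.+2.
Proof.
move=> p0 pn hx p0' pn' hz e0 e1.
have refl q m u j : (0 < q)%N -> (q < m)%N -> longest g q m u ->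
    dot (g^`() (u j.+1)) (g (u j.+1) - g (u j)) / chord g (u j) (u j.+1) =
    dot (g^`() (u j.+1)) (g (u j.+2) - g (u j.+1)) / chord g (u j.+1) (u j.+2).
  move=> q0 qm hu; apply: (reflection_law hg);
    rewrite ?(longest_lt q0 qm hu) ?(longest_lt1 q0 qm hu)// => t t1 t2 t3 t4.
  by apply: longest_local hu _ _ _ _ => //; [lia|exact: ltnW].
have ex := refl p n x i p0 pn hx; have ez := refl p' n' z k p0' pn' hz.
apply: (reflection_unique hg (x i.+1) _ _ _ _ _ _ _ (esym ex)).
- exact: longest_lt p0 pn hx _.
- exact: longest_lt1 p0 pn hx _.
- by rewrite e1; exact: longest_lt p0' pn' hz _.
- by rewrite e1; exact: longest_lt1 p0' pn' hz _.
- by rewrite e0 e1 -ez.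
Qed.

End LongestPolygons.

(** * Exchanging sides for diagonals *)

(** The polygons after both exchanges: [splice_l] runs through [y 0, x 1, ..., x j, y j.+2, ...] and
    [splice_r] through [x 0, y 1, ..., y j.+1, x j.+1, ...]. For [j = 0] the former starts with
    [y 0, y 2]. *)
Definition splice_l {R : realType} (x y : nat -> R) (j i : nat) : R :=
  if i == 0%N then y 0%N else if (i <= j)%N then x i else y i.+1.

Definition splice_r {R : realType} (x y : nat -> R) (j i : nat) : R :=
  if i == 0%N then x 0%N else if (i <= j.+1)%N then y i else x i.-1.

Lemma perimeterS {R : realType} (g : R -> R * R) (n : nat) (x : nat -> R) :
  perimeter g n.+1 x = perimeter g n x + chord g (x n) (x n.+1).
Proof. exact: big_ord_recr. Qed.

Lemma perimeter0 {R : realType} (g : R -> R * R) (x : nat -> R) :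
  perimeter g 0 x = 0.
Proof. exact: big_ord0. Qed.

Section Splice.
Context {R : realType} {g : R -> R * R} (hg : strictly_convex_unit_curve g).
Context {p m j : nat} {x y : nat -> R}.
Context (hx : rotation_sequence p m x) (hy : rotation_sequence p m.+2 y).
Context (jm : (j < m)%N) (xy0 : x 0%N <= y 0%N) (yx1 : y 1%N <= x 1%N).
Context (xyj : x j <= y j.+1) (yxj : y j.+2 <= x j.+1).

Lemma splice_l_inscribed : inscribed_polygon p m.+1 (splice_l x y j).
Proof.
have [h1 h2 h3 h4] := And4 xy0 yx1 xyj yxj; have [[_ xs] [yp ys]] := (hx, hy); split.
  by rewrite /splice_l /= leqNgt ltnW//= -[m.+2]add0n yp.
have /andP[x01 x02] := xs 0%N; have /andP[y01 y02] := ys 0%N.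
have /andP[y11 y12] := ys 1%N.
have /andP[x11 x12] := xs j; have /andP[y21 y22] := ys j.+1.
move=> i _; rewrite /splice_l /=; case: (ltngtP i j) => ij.
- case: i ij => [|i] ij /=; apply/andP.
    by split; lra.
  by have /andP[? ?] := xs i.+1; split; lra.
- rewrite (gtn_eqF (leq_ltn_trans (leq0n j) ij)).
  by have /andP[? ?] := ys i.+1; apply/andP; split; lra.
- subst i; case: eqP => [j0|_]; apply/andP; last by split; lra.
  by move: yxj; rewrite j0 => ?; split; lra.
Qed.

Lemma splice_r_inscribed : inscribed_polygon p m.+1 (splice_r x y j).
Proof.
have [h1 h2 h3 h4] := And4 xy0 yx1 xyj yxj; have [[xp xs] [yp ys]] := (hx, hy); split.
  by rewrite /splice_r /= ltnNge jm /= -[m]add0n xp.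
have /andP[x01 x02] := xs 0%N; have /andP[y01 y02] := ys 0%N.
have /andP[x11 x12] := xs j; have /andP[y21 y22] := ys j.+1.
move=> [|i] _; rewrite /splice_r /=.
  by apply/andP; split; lra.
rewrite !ltnS; case: (ltngtP i j) => ij; apply/andP.
- by have /andP[? ?] := ys i.+1; split; lra.
- by have /andP[? ?] := xs i; split; lra.
- by subst i; split; lra.
Qed.

Let w := splice_l x y j.
Let w' := splice_r x y j.

Lemma splice_l_low i : (0 < i <= j)%N -> w i = x i.
Proof. by rewrite /w /splice_l; case: i => //= i ->. Qed.

Lemma splice_l_high i : (j < i)%N -> w i = y i.+1.
Proof. by rewrite /w /splice_l; case: i => //= i ji; rewrite leqNgt ji. Qed.

Lemma splice_r_low i : (0 < i <= j.+1)%N -> w' i = y i.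
Proof. by rewrite /w' /splice_r; case: i => //= i ->. Qed.

Lemma splice_r_high i : (j < i)%N -> w' i.+1 = x i.
Proof. by move=> ji; rewrite /w' /splice_r /= ltnS leqNgt ji. Qed.

(** Here and below, the length of a path between two vertices is written as a difference of initial
    perimeters. *)
Lemma perimeter_splice_l0 i : j = 0%N ->
  perimeter g i.+1 w = chord g (y 0%N) (y 2%N) + perimeter g i.+2 y - perimeter g 2 y.
Proof.
move=> j0; elim: i => [|i IH].
  by rewrite [LHS]perimeterS perimeter0 add0r (splice_l_high 1) ?j0// addrK.
by rewrite perimeterS IH !splice_l_high ?j0// [in RHS]perimeterS; ring.
Qed.

Lemma perimeter_splice_l_low i : (i < j)%N ->
  perimeter g i.+1 w = chord g (y 0%N) (x 1%N) + perimeter g i.+1 x - perimeter g 1 x.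
Proof.
elim: i => [|i IH] ij.
  by rewrite [LHS]perimeterS perimeter0 add0r (splice_l_low 1)// addrK.
rewrite perimeterS IH ?(ltnW ij)// !splice_l_low ?(ltnW ij)//.
by rewrite [in RHS]perimeterS; ring.
Qed.

Lemma perimeter_splice_l i : (0 < j)%N ->
  perimeter g (j + i).+1 w = chord g (y 0%N) (x 1%N) + perimeter g j x - perimeter g 1 x
    + chord g (x j) (y j.+2) + perimeter g (j + i).+2 y - perimeter g j.+2 y.
Proof.
move=> j0; elim: i => [|i IH].
  rewrite addn0 [LHS]perimeterS splice_l_low ?j0 ?leqnn// splice_l_high// addrK.
  by rewrite -[in LHS](prednK j0) perimeter_splice_l_low ?prednK.
rewrite addnS perimeterS IH !splice_l_high ?ltnS ?leq_addr ?leqW ?leq_addr//.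
by rewrite [perimeter g _.+3 y]perimeterS; ring.
Qed.

Lemma perimeter_splice_r_low i : (i <= j)%N ->
  perimeter g i.+1 w' = chord g (x 0%N) (y 1%N) + perimeter g i.+1 y - perimeter g 1 y.
Proof.
elim: i => [|i IH] ij.
  by rewrite [LHS]perimeterS perimeter0 add0r (splice_r_low 1)// addrK.
rewrite perimeterS IH ?(ltnW ij)// !splice_r_low ?ltnS ?(ltnW ij)//.
by rewrite [in RHS]perimeterS; ring.
Qed.

Lemma perimeter_splice_r i :
  perimeter g (j.+1 + i).+1 w' = chord g (x 0%N) (y 1%N) + perimeter g j.+1 y
    - perimeter g 1 y + chord g (y j.+1) (x j.+1)
    + perimeter g (j.+1 + i) x - perimeter g j.+1 x.
Proof.
elim: i => [|i IH].
  rewrite addn0 [LHS]perimeterS perimeter_splice_r_low//.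
  by rewrite splice_r_low ?leqnn// splice_r_high// addrK.
rewrite addnS perimeterS IH !splice_r_high ?leq_addr ?(leqW (leq_addr _ _))//.
by rewrite [perimeter g (_ + _).+1 x]perimeterS; ring.
Qed.

(* Every exchange replaces two opposite sides of a quadrilateral inscribed in
   the curve by its diagonals. *)
Lemma splice_perimeter : (forall i, y i < y i.+1) ->
  perimeter g m x + perimeter g m.+2 y <= perimeter g m.+1 w + perimeter g m.+1 w' /\
  (perimeter g m x + perimeter g m.+2 y = perimeter g m.+1 w + perimeter g m.+1 w' ->
   (x 0%N = y 0%N \/ (0 < j)%N /\ x 1%N = y 1%N) /\
   (x j = y j.+1 \/ y j.+2 = x j.+1)).
Proof.
move=> ylt; have [g1 g2 g3 g4] := And4 xy0 yx1 xyj yxj; have [[_ xs] [_ ys]] := (hx, hy).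
have /andP[x01 x02] := xs 0%N; have y01 := ylt 0%N; have y12 := ylt 1%N.
have /andP[x11 x12] := xs j; have y21 := ylt j.+1.
have QA := chord_quad hg _ _ _ _ xy0 (ltW y01) yx1 x02.
have Er := perimeter_splice_r (m - j.+1); rewrite subnKC// in Er.
have P1 u : perimeter g 1 u = chord g (u 0%N) (u 1%N).
  by rewrite perimeterS perimeter0 add0r.
(* For [j = 0] the second exchange acts on the diagonal from [y 0] to [x 1] that the first one has
   produced, and on the side from [y 1] to [y 2]. *)
case: (posnP j) => [j0|j0].
  have El := perimeter_splice_l0 m j0.
  have y2x1 : y 2%N <= x 1%N by move: yxj; rewrite j0.
  have x1y0 : x 1%N <= y 0%N + 1 by lra.
  have QB := chord_quad hg _ _ _ _ (ltW y01) (ltW y12) y2x1 x1y0.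
  rewrite El Er j0 !P1 [perimeter g 2 y]perimeterS P1.
  split; first by lra.
  move=> e; have x0y0 : x 0%N = y 0%N.
    apply/eqP; rewrite eq_le xy0 leNgt; apply/negP => h.
    have := chord_quad_lt hg _ _ _ _ h (ltW y01) (lt_le_trans y12 y2x1) x02; lra.
  split; [by left|right]; apply/eqP; rewrite eq_le y2x1 leNgt; apply/negP => h.
  have := chord_quad_lt hg _ _ _ _ y01 (ltW y12) h x1y0; lra.
have El := perimeter_splice_l (m - j) j0; rewrite subnKC ?(ltnW jm)// in El.
have QB := chord_quad hg _ _ _ _ xyj (ltW y21) yxj x12.
rewrite El Er !P1 [perimeter g j.+1 x]perimeterS [perimeter g j.+2 y]perimeterS.
split; first by lra.
move=> e; split.
  have [x0y0|x0y0] := eqVneq (x 0%N) (y 0%N); first by left.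
  right; split=> //; apply/eqP; rewrite eq_sym eq_le yx1 leNgt; apply/negP => h.
  have {}x0y0 : x 0%N < y 0%N by rewrite lt_neqAle x0y0.
  have := chord_quad_lt hg _ _ _ _ x0y0 (ltW y01) h x02; lra.
have [xjyj|xjyj] := eqVneq (x j) (y j.+1); first by left.
right; apply/eqP; rewrite eq_le yxj leNgt; apply/negP => h.
have {}xjyj : x j < y j.+1 by rewrite lt_neqAle xjyj.
have := chord_quad_lt hg _ _ _ _ xjyj (ltW y21) h x12; lra.
Qed.

End Splice.

(** * The strict inequality *)

Section Concavity.
Context {R : realType} {g : R -> R * R} (hg : strictly_convex_unit_curve g).

Lemma rotation_sequence_full (n : nat) (x : nat -> R) : (0 < n)%N ->
  rotation_sequence n n x -> forall i, x i.+1 = x i + 1.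
Proof.
case: n => [//|n] _ hx i; have [xp xs] := hx.
apply/eqP; rewrite eq_le; have /andP[_ -> /=] := xs i.
have := rotation_sequence_leD _ _ _ i.+1 n hx.
by rewrite addSnnS xp -natr1; lra.
Qed.

(* When [p = n] every polygon is degenerate and any starting point will do. *)
Lemma longest_full (n : nat) (t : R) : (0 < n)%N ->
  longest g n n (fun i => t + i%:R).
Proof.
move=> n0; have [x [hx xmax]] := exists_longest hg n n n0 (leqnn n).
have deg u : (forall i, u i.+1 = u i + 1) -> perimeter g n u = 0.
  move=> us; apply: big1 => i _.
  by rewrite us -[enorm _]/(chord g _ _) (chordSr hg) chordxx.
split; last first.
  rewrite -xmax !deg// => i; first exact: (rotation_sequence_full n).
  by rewrite -natr1 addrA.
by split=> i; [rewrite natrD addrA|rewrite -natr1 addrA lexx lerDl ler01].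
Qed.

(** Up to integers [y] takes only [n] values; [t] is chosen between their greatest fractional part
    and 1. *)
Lemma exists_generic (p n : nat) (y : nat -> R) : (0 < n)%N -> rotation_sequence p n y ->
  exists t : R, forall i k, t + i%:R <> y k.
Proof.
move=> n0 hy; pose fr (r : R) := r - (Num.floor r)%:~R.
have fr01 r : 0 <= fr r < 1.
  by rewrite /fr subr_ge0 floor_le /= ltrBlDr addrC -[1]/(1%:~R) -intrD floorD1_gt.
have frD r (k : nat) : fr (r + k%:R) = fr r.
  rewrite /fr -[k%:R]/((Posz k)%:~R) floorDrz ?intr_int// intrD.
  by rewrite intrKfloor opprD addrACA subrr addr0.
pose M := \big[Num.max/0]_(i < n) fr (y i).
have M1 : M < 1 by apply: bigmax_lt => // i _; case/andP: (fr01 (y i)).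
have M0 : 0 <= M by exact: bigmax_ge_id.
pose t := (M + 1) / 2.
have t01 : 0 <= t < 1 by rewrite /t; lra.
have frt : fr t = t.
  have -> : fr t = t - 0%:~R by rewrite /fr (floor_def (m := 0))// add0r.
  by rewrite subr0.
exists t => i k e.
have : fr (y k) <= M.
  rewrite (divn_eq k n) addnC (rotation_sequenceM _ _ _ _ _ hy) frD.
  exact: (@le_bigmax _ _ _ 0 (fun i : 'I_n => fr (y i)) (Ordinal (ltn_pmod k n0))).
by rewrite -e frD frt /t; lra.
Qed.

(** By the reflection law [x] and [y] agree from [s] on; then
    [y (s + m) = x s + p%:R = y (s + m.+2)], but [y] increases strictly. *)
Lemma longest_no_common_side p m (x y : nat -> R) s : (0 < p)%N -> (p < m)%N ->
  longest g p m x -> longest g p m.+2 y ->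
  x s = y s -> x s.+1 = y s.+1 -> False.
Proof.
move=> p0 pm hx hy e0 e1; have pm2 : (p < m.+2)%N := leqW (leqW pm).
have key i : x (s + i)%N = y (s + i)%N /\ x (s + i).+1 = y (s + i).+1.
  elim: i => [|i [h0 h1]]; first by rewrite addn0.
  rewrite addnS; split=> //.
  exact: (longest_determined hg p m x p m.+2 y (s + i) (s + i) p0 pm hx p0 pm2 hy).
have [h _] := key m; have [[xp _] _] := hx; have [[yp _] _] := hy.
have := longest_lt hg p0 pm2 hy (s + m); have := longest_lt hg p0 pm2 hy (s + m).+1.
by rewrite -h xp -!addnS yp e0; lra.
Qed.

Lemma max_perimeter_concave (p m : nat) : (0 < p)%N -> (p <= m)%N ->
  max_perimeter g p m + max_perimeter g p m.+2 < 2 * max_perimeter g p m.+1.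
Proof.
move=> p0 pm; have m0 : (0 < m)%N := leq_trans p0 pm.
have pm2 : (p < m.+2)%N := leqW (pm : (p < m.+1)%N).
have [y0 hy0] := exists_longest hg p m.+2 isT (ltnW pm2).
have [x0 [hx0 gen]] : exists x0, longest g p m x0 /\
    ((p < m)%N \/ forall i k, x0 i <> y0 k).
  move: pm; rewrite leq_eqVlt => /predU1P[e|pm].
    have [t ht] := exists_generic _ _ _ (isT : 0 < m.+2)%N hy0.1.
    by exists (fun i => t + i%:R); split; [rewrite e; exact: longest_full|right].
  by have [x hx] := exists_longest hg p m m0 (ltnW pm); exists x; split => //; left.
have [i [k [a1 a2 a3]]] := exists_nested_arc _ _ _ _ p0 m0 hx0.1 hy0.1.
have hx := longest_shift hg _ _ _ i hx0; have hy := longest_shift hg _ _ _ k hy0.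
set x := fun j => _ in hx; set y := fun j => _ in hy.
have {}gen : (p < m)%N \/ forall i k, x i <> y k.
  by case: gen => h; [left|right => a b; exact: h].
have b1 : x 0%N <= y 0%N by rewrite /x /y !add0n.
have b2 : y 1%N <= x 1%N by rewrite /x /y !add1n.
have b3 : y m.+1 < x m by rewrite /x /y addnC [(m + i)%N]addnC.
have ylt := longest_lt hg p0 pm2 hy.
(* The least such [j] is where [y] has first gained a vertex on [x]; by [b3] this happens at [m.-1]
   at the latest. *)
have ex : exists j, (fun j => y j.+2 <= x j.+1) j.
  by exists m.-1; rewrite (prednK m0) ltW.
have [j c1 jmin] := ex_minnP ex.
have jm : (j < m)%N.
  by rewrite -(prednK m0) ltnS; apply: jmin; rewrite (prednK m0) ltW.
have c2 : x j <= y j.+1.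
  case: j c1 jmin jm => [|j] c1 jmin _; first exact: le_trans b1 (ltW (ylt 0%N)).
  by rewrite leNgt; apply/negP => /ltW/jmin; rewrite ltnn.
have [le_perim eq_perim] := splice_perimeter hg hx.1 hy.1 jm b1 b2 c2 c1 ylt.
have pm1 : (p <= m.+1)%N := leqW pm.
have hr := splice_r_inscribed hx.1 hy.1 jm b1 b2 c2 c1.
have hl := splice_l_inscribed hx.1 hy.1 jm b1 b2 c2 c1.
have ubl := le_max_perimeter hg _ _ _ pm1 hl.
have ubr := le_max_perimeter hg _ _ _ pm1 hr.
rewrite hx.2 hy.2 in le_perim eq_perim.
(* The reverse inequality turns all the estimates into equalities, so both spliced polygons are
   longest. *)
rewrite ltNge; apply/negP => le_max.
have er : perimeter g m.+1 (splice_r x y j) = max_perimeter g p m.+1 by lra.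
have [A B] : (x 0%N = y 0%N \/ (0 < j)%N /\ x 1%N = y 1%N) /\
   (x j = y j.+1 \/ y j.+2 = x j.+1) by apply: eq_perim; lra.
case: gen => [{}pm|gen]; last by case: A => [|[_]]; exact: gen.
have [z hz zE] := longest_ext p m.+1 _ isT hr er.
have det := longest_determined hg p m x p m.+1 z _ _
  p0 pm hx p0 (ltnW pm : (p < m.+1)%N) hz.
case: A => [x0y0|[j0 x1y1]]; last first.
  (* As [j] is positive, [z] starts with [x 0, x 1, y 2], which gives [x 2 = y 2]. *)
  apply: (longest_no_common_side p m x y 1 p0 pm hx hy x1y1).
  have z2 : z 2%N = y 2%N by rewrite zE ?splice_r_low//= ltnS.
  rewrite -z2; apply: (det 0%N 0%N).
    by rewrite zE.
  by rewrite zE// splice_r_low.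
(* One turn of [z] ends with [x m.-1, x m], and its next vertex is [y 1], one period later; so
   [x 1 = y 1]. *)
apply: (longest_no_common_side p m x y 0 p0 pm hx hy x0y0).
have mE : m = m.-1.+1 by rewrite prednK.
have zm : z m.-1.+1 = x m.-1.
  rewrite zE; last by rewrite -mE leqnSn.
  have [jm1|jm1] := ltnP j m.-1; first by rewrite splice_r_high.
  have jE : j = m.-1 by apply/eqP; rewrite eqn_leq jm1 andbT -ltnS -mE.
  rewrite splice_r_low; last by rewrite jE ltnS leqnn.
  (* For [j = m.-1] the vertex is [y m]; it equals [x m.-1], because the strict inequality [b3]
     excludes the other alternative. *)
  case: B; rewrite jE// -mE => e.
  by move: b3; rewrite e ltxx.
have zm1 : z m.-1.+2 = x m.-1.+1.
  by rewrite -mE zE// splice_r_high.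
have [[zp _] _] := hz; have [[xp _] _] := hx.
have := det m.-1 m.-1.+1 (esym zm) (esym zm1).
have -> : m.-1.+2 = (1 + m)%N by rewrite -mE.
rewrite -addnS xp zp => /addIr ->; rewrite zE// splice_r_low//.
Qed.

End Concavity.

Theorem mainTheorem2 (R : realType) (g : R -> R * R)
    (hg : strictly_convex_unit_curve g) (p q : nat)
    (hp : (0 < p)%N) (hpq : (p < q)%N) (hcop : coprime p q) :
  max_perimeter g p q.-1 + max_perimeter g p q.+1 < 2 * max_perimeter g p q.
Proof.
case: q hpq {hcop} => // m pm; exact: (max_perimeter_concave hg).
Qed.
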